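(* Let $\kappa$, $\lambda$ be regular cardinals, let $\mathcal{K}$ be a $\lambda$-accessible category that has $\kappa$-directed colimits, and let $F:\mathcal{K}\to\mathcal{L}$ be a faithful functor that preserves $\kappa$-directed colimits and sends $\lambda$-presentable objects to $\lambda$-presentable objects. Then for every regular cardinal $\mu$ with $\kappa\triangleleft\mu$ and $\mu\geq\lambda$, $F$ sends $\mu$-presentable objects of $\mathcal{K}$ to $\mu$-presentable objects of $\mathcal{L}$.
   Context: For a regular cardinal $\theta$, a $\theta$-directed colimit is a colimit of a diagram indexed by a $\theta$-directed poset; an object $M$ is $\theta$-presentable if $\mathrm{Hom}(M,-)$ preserves $\theta$-directed colimits; a category is $\theta$-accessible if it has $\theta$-directed colimits and has a set of $\theta$-presentable objects such that every object is a $\theta$-directed colimit of objects from that set. For regular cardinals $\kappa<\mu$, write $\kappa\triangleleft\mu$ (''$\kappa$ is sharply less than $\mu$'') if for every set $X$ with $|X|<\mu$, the poset $P_{<\kappa}(X)$ of subsets of $X$ of cardinality less than $\kappa$ (ordered by inclusion) has a cofinal subset of cardinality less than $\mu$. (Equivalently: in every $\kappa$-directed poset, every subset of fewer than $\mu$ elements is contained in a $\kappa$-directed subset of fewer than $\mu$ elements.)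
   Formalization: The formal theorem adds the hypothesis κ ≤ λ, which the English leaves tacit; for κ > λ the claim is false (e.g. λ=ℵ0, κ=ℵ1, μ=ℵ2 with a functor on Set built from an ultrapower). *)

(* Defs.v *)
From mathcomp Require Import all_boot.
From mathcomp Require Import boolp classical_sets functions cardinality.
From Corelib Require Import Relation_Definitions.
Set Implicit Arguments.
Unset Strict Implicit.
Unset Printing Implicit Defensive.
Local Open Scope classical_set_scope.
Local Open Scope card_scope.
Local Obligation Tactic := idtac.

(* The universe of "sets".  Hom-sets, index posets and cardinals live in it;
   objects of a category may live in a larger universe (the instance
   [types_cat] below makes the inequality strict). *)
Definition smallType := Type.

(** * Cardinals *)

(* A cardinal is represented by any type of that cardinality; every notion
   below depends on the type only up to bijection. *)

Definition card_lt (T U : Type) (A : set T) (B : set U) : Prop :=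
  A #<= B /\ ~ (B #<= A).
Notation "A '#<' B" := (card_lt A B) (at level 79) : card_scope.

(* Infinite, and not reached by unions of fewer than [theta] sets of
   cardinality less than [theta]. *)
Definition regular_cardinal (theta : smallType) : Prop :=
  infinite_set [set: theta] /\
  forall (I T : smallType) (A : I -> set T),
    [set: I] #< [set: theta] -> (forall i, A i #< [set: theta]) ->
    \bigcup_i A i #< [set: theta].

Definition small_subsets (kappa X : smallType) : set (set X) :=
  [set A | A #< [set: kappa]].
Arguments small_subsets kappa X : clear implicits.

Definition sharply_less (kappa mu : smallType) : Prop :=
  [set: kappa] #< [set: mu] /\
  forall X : smallType, [set: X] #< [set: mu] ->
    exists C : set (set X),
      [/\ C `<=` small_subsets kappa X,
          forall A, small_subsets kappa X A -> exists2 B, C B & A `<=` B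
        & C #< [set: mu]].

(** * Categories and functors *)

Record category := Category {
  obj :> Type;
  hom : obj -> obj -> smallType;
  idm : forall a, hom a a;
  hcomp : forall a b c, hom b c -> hom a b -> hom a c;
  hcomp1m : forall a b (f : hom a b), hcomp (idm b) f = f;
  hcompm1 : forall a b (f : hom a b), hcomp f (idm a) = f;
  hcompA : forall a b c d (h : hom c d) (g : hom b c) (f : hom a b),
    hcomp h (hcomp g f) = hcomp (hcomp h g) f }.
Arguments idm {c0} a : rename.
Notation "g \oc f" := (hcomp g f) (at level 50, left associativity).

Record functor (K L : category) := Functor {
  fobj :> K -> L;
  fmap : forall a b : K, hom a b -> hom (fobj a) (fobj b);
  fmap1 : forall a : K, fmap (idm a) = idm (fobj a);
  fmapM : forall (a b c : K) (g : hom b c) (f : hom a b),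
    fmap (g \oc f) = fmap g \oc fmap f }.
Arguments fmap {K L} f {a b} _ : rename.

Definition faithful (K L : category) (F : functor K L) : Prop :=
  forall a b : K, injective (@fmap K L F a b).

Program Definition functor_comp (J K L : category)
    (F : functor K L) (D : functor J K) : functor J L :=
  {| fobj := fun j => F (D j); fmap := fun i j f => fmap F (fmap D f) |}.
Next Obligation. by move=> J K L F D a; rewrite /= !fmap1. Qed.
Next Obligation. by move=> J K L F D a b c g f; rewrite /= !fmapM. Qed.

Definition types_cat : category :=
  {| obj := smallType;
     hom := fun A B : smallType => A -> B;
     idm := fun A x => x;
     hcomp := fun A B C g f x => g (f x);
     hcomp1m := fun _ _ _ => erefl;
     hcompm1 := fun _ _ _ => erefl;
     hcompA := fun _ _ _ _ _ _ _ => erefl |}.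

Program Definition hom_functor (K : category) (M : K) : functor K types_cat :=
  {| fobj := fun a => hom M a : types_cat; fmap := fun a b f g => f \oc g |}.
Next Obligation. by move=> K M a; apply: funext => g; rewrite hcomp1m. Qed.
Next Obligation.
by move=> K M a b c g f; apply: funext => h; rewrite /= hcompA.
Qed.

(** * Directed colimits *)

(* [order] is the standard library's reflexive, transitive and antisymmetric
   relations; MathComp's [porderType] would tie [smallType] to its universe. *)
Record poset := Poset {
  pelt : smallType;
  ple : relation pelt;
  ple_order : order pelt ple }.

Definition directed (theta : smallType) (I : poset) : Prop :=
  forall A : set (pelt I), A #< [set: theta] ->
    exists i : pelt I, forall a, A a -> ple a i.

Program Definition poset_cat (I : poset) : category :=
  {| obj := pelt I;
     hom := fun i j => ple i j;
     idm := ord_refl _ _ (ple_order I);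
     hcomp := fun i j k jk ij => ord_trans _ _ (ple_order I) i j k ij jk |}.
Next Obligation. by move=> I i j f; apply: Prop_irrelevance. Qed.
Next Obligation. by move=> I i j f; apply: Prop_irrelevance. Qed.
Next Obligation. by move=> I i j k l h g f; apply: Prop_irrelevance. Qed.

Record cocone (J K : category) (D : functor J K) (M : K) := Cocone {
  leg : forall j, hom (D j) M;
  leg_nat : forall (i j : J) (f : hom i j), leg j \oc fmap D f = leg i }.

Definition is_colimit (J K : category) (D : functor J K) (M : K)
    (c : cocone D M) : Prop :=
  forall (N : K) (c' : cocone D N),
    exists! u : hom M N, forall j, u \oc leg c j = leg c' j.

Program Definition map_cocone (J K L : category) (F : functor K L)
    (D : functor J K) (M : K) (c : cocone D M) :
    cocone (functor_comp F D) (F M) :=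
  {| leg := fun j => fmap F (leg c j) |}.
Next Obligation.
by move=> J K L F D M c i j f; rewrite /= -fmapM leg_nat.
Qed.

Definition has_directed_colimits (theta : smallType) (K : category) : Prop :=
  forall I : poset, directed theta I ->
  forall D : functor (poset_cat I) K,
    exists (M : K) (c : cocone D M), is_colimit c.

(* Only the directed colimits that exist in [K] are considered. *)
Definition preserves_directed_colimits (theta : smallType) (K L : category)
    (F : functor K L) : Prop :=
  forall I : poset, directed theta I ->
  forall (D : functor (poset_cat I) K) (M : K) (c : cocone D M),
    is_colimit c -> is_colimit (map_cocone F c).

Definition presentable (theta : smallType) (K : category) (M : K) : Prop :=
  preserves_directed_colimits theta (hom_functor M).

(* The set of presentable objects is the range of the small family [G]. *)
Definition accessible (theta : smallType) (K : category) : Prop :=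
  has_directed_colimits theta K /\
  exists (S : smallType) (G : S -> K),
    (forall s, presentable theta (G s)) /\
    forall M : K,
      exists (I : poset) (D : functor (poset_cat I) K) (c : cocone D M),
        [/\ directed theta I,
            forall i, exists s, D i = G s
          & is_colimit c].

(* Main.v *)
(* Write [M] as a [lambda]-directed colimit of [lambda]-presentable objects,
   indexed by [I].  Since [kappa] is sharply less than [mu], the [mu]-small
   [kappa]-directed subsets [J] of [I] form a [mu]-directed poset covering [I],
   and [M] is the [mu]-directed colimit of the partial colimits [M_J], which
   exist because [K] has [kappa]-directed colimits.  If [M] is
   [mu]-presentable, its identity factors through some [M_J], so [F M] is a
   retract of [F M_J].  The latter is a [mu]-small colimit of
   [mu]-presentable objects, as [F] preserves the colimit [M_J]. *)
Require Import Defs.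
From mathcomp Require Import all_boot.
From mathcomp Require Import boolp classical_sets functions cardinality.
From mathcomp Require Import wochoice.
From Stdlib Require Import Inverse_Image.
From Corelib Require Import Relation_Definitions.
Set Implicit Arguments.
Unset Strict Implicit.
Unset Printing Implicit Defensive.
Local Open Scope classical_set_scope.
Local Open Scope card_scope.
Local Obligation Tactic := idtac.

(** * Cardinalities below a regular cardinal *)

Lemma card_le_lt_trans (T U V : Type) (B : set U) (A : set T) (C : set V) :
  A #<= B -> B #< C -> A #< C.
Proof.
move=> AB [BC CB]; split; first exact: card_le_trans AB BC.
by move=> CA; apply: CB; exact: card_le_trans CA AB.
Qed.

Lemma card_lt_le_trans (T U V : Type) (B : set U) (A : set T) (C : set V) :
  A #< B -> B #<= C -> A #< C.
Proof.
move=> [AB BA] BC; split; first exact: card_le_trans AB BC.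
by move=> CA; apply: BA; exact: card_le_trans BC CA.
Qed.

Lemma card_lt_sub (T U : Type) (A B : set T) (C : set U) :
  A `<=` B -> B #< C -> A #< C.
Proof. by move=> /subset_card_le; exact: card_le_lt_trans. Qed.

Lemma card_lt_image (T U V : Type) (f : T -> U) (A : set T) (C : set V) :
  A #< C -> f @` A #< C.
Proof. by apply: card_le_lt_trans; exact: card_image_le. Qed.

Lemma finite_card_lt (T U : Type) (A : set T) (B : set U) :
  finite_set A -> infinite_set B -> A #< B.
Proof.
move=> finA infB; split; last by move/card_le_finite/(_ finA).
have /finite_set_leP[n /card_le_trans] := finA; apply.
by move/infiniteP : infB; apply: card_le_trans; exact: card_leT.
Qed.

Section RegularCardinal.
Variables (theta : smallType) (theta_regular : regular_cardinal theta).

(** Regularity speaks of unions indexed by a whole type; passing to the subtype of [D] reduces to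
    that case. *)
Lemma card_lt_bigcup (I T : smallType) (D : set I) (A : I -> set T) :
  D #< [set: theta] -> (forall i, D i -> A i #< [set: theta]) ->
  \bigcup_(i in D) A i #< [set: theta].
Proof.
move=> Dlt Alt.
have -> : \bigcup_(i in D) A i = \bigcup_(i : D) A (set_val i).
  apply/seteqP; split=> x.
    by move=> [i Di Aix]; exists (SigSub (mem_set Di)).
  by move=> [i _ Aix]; exists (set_val i) => //; exact: set_valP.
apply: theta_regular.2 => [|i]; last by apply: Alt; exact: set_valP.
by apply: card_le_lt_trans Dlt; rewrite (card_le_eql (card_setT D)).
Qed.

Lemma card_lt_setU (T : smallType) (A B : set T) :
  A #< [set: theta] -> B #< [set: theta] -> A `|` B #< [set: theta].
Proof.
move=> Alt Blt.
have -> : A `|` B = \bigcup_(b : bool) (if b then A else B).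
  apply/seteqP; split=> x.
    by case=> ?; [exists true|exists false].
  by move=> [[] _ ?]; [left|right].
apply: card_lt_bigcup => [|[] _ //].
by apply: finite_card_lt theta_regular.1; exact: finite_finset.
Qed.

Lemma card_lt_setX (T U : smallType) (A : set T) (B : set U) :
  A #< [set: theta] -> B #< [set: theta] -> A `*` B #< [set: theta].
Proof.
move=> Alt Blt.
have -> : A `*` B = \bigcup_(a in A) ((fun b => (a, b)) @` B).
  apply/seteqP; split=> [[a b] [/= Aa Bb]|x [a Aa [b Bb <-]]] //.
  by exists a => //; exists b.
by apply: card_lt_bigcup => // a Aa; exact: card_lt_image.
Qed.

End RegularCardinal.

(* [W] is an initial segment, of size [kappa] but with smaller proper initial
   segments, of some well-order of [kappa]. *)
Lemma regular_well_founded (kappa : smallType) : regular_cardinal kappa ->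
  exists (W : smallType) (R : W -> W -> Prop),
    [/\ well_founded R, [set: W] #<= [set: kappa]
      & forall B : set W, B #< [set: kappa] ->
          exists w, forall b, B b -> R b w].
Proof.
move=> kreg.
have [R woR] := well_ordering_principle {classic kappa}.
have minR (A : set kappa) : A !=set0 ->
    exists2 z : kappa, A z & forall x, A x -> R z x.
  move=> [x Ax]; have [|z [[zA zle] _]] := woR (mem A).
    by exists x; exact: mem_set.
  by exists z; [exact: set_mem|move=> y Ay; apply: zle; exact: mem_set].
have chR : wo_chain R predT := withinW woR.
have Ranti (x y : kappa) : R x y -> R y x -> x = y.
  by move=> xy yx; apply: (wo_chain_antisymmetric chR) => //; apply/andP.
(* As [R] is total, its negated converse is the strict order. *)
pose lt (x y : kappa) : Prop := ~ R y x.
have lt_wf : well_founded lt.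
  move=> x; apply: contrapT => nx.
  have [|z nz zle] := minR [set z | ~ Acc lt z]; first by exists x.
  apply: nz; constructor=> y yz; apply: contrapT => ny; exact/yz/zle.
pose seg (x : kappa) := [set y | lt y x].
(* Either all initial segments are smaller than [kappa], and [W] is everything, or [W] is the
   segment below the least point whose segment is not. *)
have [W [WK Wseg]] : exists W : set kappa,
    [set: kappa] #<= W /\ forall w, W w -> seg w #< [set: kappa].
  have [Hall|] := pselect (forall w, seg w #< [set: kappa]).
    by exists setT.
  move=> /existsNP[w nw].
  have [|z nz zle] := minR [set z | ~ (seg z #< [set: kappa])].
    by exists w.
  exists (seg z); split.
    apply: contrapT => nle; apply: nz; split => //; exact: card_leT.
  move=> y yz; apply: contrapT => ny; exact/yz/zle.
exists W, (fun x y => lt (set_val x) (set_val y)); split.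
- by apply: wf_inverse_image.
- by rewrite (card_le_eql (card_setT W)); exact: card_leT.
move=> B Blt.
(* Were [B] without a strict upper bound, fewer than [kappa] closed initial segments, each smaller
   than [kappa], would cover [W], against regularity. *)
have [C|/existsNP[w]] := pselect (forall w : W,
    exists2 b, B b & ~ lt (set_val b) (set_val w)); last first.
  move=> nw; exists w => b Bb; apply: contrapT => nlt; apply: nw.
  by exists b.
suff [_ []] :
    \bigcup_(b in B) (seg (set_val b) `|` [set set_val b]) #< [set: kappa].
  apply: card_le_trans WK _; apply: subset_card_le => w Ww.
  have [b Bb nbw] := C (SigSub (mem_set Ww)).
  exists b => //; have [wb|nwb] := pselect (lt w (set_val b)); [by left|right].
  apply: Ranti; exact: contrapT.
apply: card_lt_bigcup => // b _; apply: card_lt_setU => //.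
  by apply: Wseg; exact: set_valP.
by apply: finite_card_lt kreg.1; exact: finite_set1.
Qed.

(** * Small directed subsets of a directed poset *)

Lemma sub_ple_order (I : poset) (J : set (pelt I)) :
  order J (fun x y : J => ple (set_val x) (set_val y)).
Proof.
split.
- by move=> x; exact: (ord_refl _ _ (ple_order I)).
- by move=> x y z; exact: (ord_trans _ _ (ple_order I)).
- move=> x y xy yx; apply: val_inj.
  exact: (ord_antisym _ _ (ple_order I)) xy yx.
Qed.

Definition subposet (I : poset) (J : set (pelt I)) : poset :=
  Poset (sub_ple_order J).

Section DirectedClosure.
Variables (kappa mu : smallType).
Hypotheses (kappa_regular : regular_cardinal kappa).
Hypotheses (mu_regular : regular_cardinal mu).
Hypotheses (kappa_mu : sharply_less kappa mu).
Variables (I : poset) (I_directed : directed kappa I).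

(** The cofinality half of [sharply_less] enters here: it suffices to bound each member of a cofinal
    family of [kappa]-small subsets of [X], and there are fewer than [mu] of them. *)
Lemma small_upper_bounds (X : set (pelt I)) : X #< [set: mu] ->
  exists2 U : set (pelt I), U #< [set: mu]
    & forall B, B #< [set: kappa] -> B `<=` X ->
        exists2 u, U u & forall b, B b -> ple b u.
Proof.
move=> Xlt.
have [|C [Cs Cc Clt]] := kappa_mu.2 X.
  by apply: card_le_lt_trans Xlt; rewrite (card_le_eql (card_setT X)).
have /choice[ub ubP] (c : set X) : exists i : pelt I,
    C c -> forall x, c x -> ple (set_val x) i.
  have [Cc'|nC] := pselect (C c).
    have [|i iP] := I_directed (A := set_val @` c).
      by apply: card_lt_image; exact: Cs.
    by exists i => _ x cx; apply: iP; exists x.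
  (* Outside [C] any element will do; bounding the empty set shows that [I] is inhabited. *)
  have [|i _] := I_directed (A := set0); last by exists i.
  by apply: finite_card_lt kappa_regular.1; exact: finite_set0.
exists (ub @` C); first exact: card_lt_image.
move=> B Blt BX; have [|c Ccc Bc] := Cc [set x | B (set_val x)].
  apply: card_le_lt_trans Blt; apply: card_ge_preimage.
  by move=> x y _ _; exact: val_inj.
exists (ub c); first by exists c.
by move=> b Bb; apply: (ubP c Ccc (SigSub (mem_set (BX b Bb)))); exact: Bc.
Qed.

(* Upper bounds of small subsets are added [kappa] times; by regularity, a
   small subset of the union is already contained in one of the stages. *)
Lemma directed_closure (A : set (pelt I)) : A #< [set: mu] ->
  exists J : set (pelt I),
    [/\ A `<=` J, J #< [set: mu] & directed kappa (subposet J)].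
Proof.
move=> Alt.
(* The empty set is a junk value for large [X]; the recursion below only meets [mu]-small stages. *)
have /choice[step stepP] (X : set (pelt I)) : exists U : set (pelt I),
    X #< [set: mu] -> U #< [set: mu] /\
    forall B, B #< [set: kappa] -> B `<=` X ->
      exists2 u, U u & forall b, B b -> ple b u.
  have [/small_upper_bounds[U Ult UP]|nX] := pselect (X #< [set: mu]).
    by exists U.
  by exists set0.
have [W [R [Rwf Wle Wub]]] := regular_well_founded kappa_regular.
pose next (X : set (pelt I)) := X `|` step X.
pose X := Fix Rwf (fun _ => set (pelt I)) (fun w rec =>
  A `|` [set i | exists v (vw : R v w), next (rec v vw) i]).
have XE w : X w = A `|` \bigcup_(v in [set v | R v w]) next (X v).
  rewrite /X Fix_eq; last first.
    by move=> u f g fg; congr (_ `|` _); apply: funext => i; apply: propext;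
       split=> -[v [vu fi]]; exists v, vu; rewrite ?fg // -fg.
  by congr (_ `|` _); apply/seteqP; split=> i;
     [move=> [v [vw ?]]; exists v|move=> [v vw ?]; exists v, vw].
have Wlt : [set: W] #< [set: mu] := card_le_lt_trans Wle kappa_mu.1.
have Xlt w : X w #< [set: mu].
  elim: w / (Rwf w) => w _ IH; rewrite XE; apply: card_lt_setU => //.
  apply: card_lt_bigcup => [//||v /IH vlt]; first exact: card_lt_sub Wlt.
  by apply: card_lt_setU => //; have [] := stepP _ vlt.
exists (\bigcup_w X w); split.
- have [|w _] := Wub set0.
    by apply: finite_card_lt kappa_regular.1; exact: finite_set0.
  by move=> a Aa; exists w => //; rewrite XE; left.
- by apply: card_lt_bigcup.
move=> B Blt.
(* Each element of [B] appears at some stage, so [B] lies in a stage [w] above all of these. Its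
   upper bound is in [step (X w)], hence in any later stage [w']. *)
have /choice[st stP] (b : \bigcup_w X w) : exists w, X w (set_val b).
  by have [w _ ?] := set_valP b; exists w.
have [|w wP] := Wub (st @` B); first exact: card_lt_image.
have [|w' ww'] := Wub [set w].
  by apply: finite_card_lt kappa_regular.1; exact: finite_set1.
have [||u uX uP] := (stepP _ (Xlt w)).2 (set_val @` B).
- exact: card_lt_image.
- move=> _ [b Bb <-]; rewrite XE; right; exists (st b).
    by apply: wP; exists b.
  by left; exact: stP.
have uU : (\bigcup_w X w) u.
  by exists w' => //; rewrite XE; right; exists w; [exact: ww'|right].
by exists (SigSub (mem_set uU)) => b Bb; apply: uP; exists b.
Qed.

End DirectedClosure.


(** * Presentability as a factorization property *)

Definition bounded_pairs (I : poset) : Prop :=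
  forall i j : pelt I, exists2 k, ple i k & ple j k.

Lemma directed_bounded_pairs (theta : smallType) (I : poset) :
  regular_cardinal theta -> directed theta I -> bounded_pairs I.
Proof.
move=> theta_regular dirI i j; have [|k kP] := dirI [set i; j].
  by apply: finite_card_lt theta_regular.1; exact: finite_set2.
by exists k; apply: kP; [left|right].
Qed.

Lemma colimit_hom_ext (J K : category) (D : functor J K) (M : K)
    (c : cocone D M) (N : K) (f g : hom M N) :
  is_colimit c -> (forall j, f \oc leg c j = g \oc leg c j) -> f = g.
Proof.
move=> colc fg.
have nat (i j : J) (u : hom i j) : (f \oc leg c j) \oc fmap D u = f \oc leg c i.
  by rewrite -hcompA leg_nat.
have [u [_ uU]] := colc N (Cocone nat).
by rewrite -(uU f) // -(uU g).
Qed.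

Section PosetDiagram.
Variables (K : category) (I : poset) (D : functor (poset_cat I) K).

Definition dmap (i j : pelt I) (ij : ple i j) : hom (D i) (D j) :=
  fmap D (ij : @hom (poset_cat I) i j).

Lemma ple_trans (i j k : pelt I) : ple i j -> ple j k -> ple i k.
Proof. exact: (ord_trans _ _ (ple_order I)). Qed.

(** The proof [ik] is arbitrary, by proof irrelevance, so that different paths between two indices
    can be compared. *)
Lemma dmap_comp i j k (ij : ple i j) (jk : ple j k) (ik : ple i k) :
  dmap jk \oc dmap ij = dmap ik.
Proof.
by rewrite /dmap -fmapM; congr (fmap D _); exact: (@Prop_irrelevance (ple i k)).
Qed.

Lemma leg_dmap (M : K) (c : cocone D M) i j (ij : ple i j) :
  leg c j \oc dmap ij = leg c i.
Proof. exact: leg_nat. Qed.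

End PosetDiagram.

Section HomColimit.
Variables (K : category) (I : poset) (I_pairs : bounded_pairs I).
Variables (D : functor (poset_cat I) K) (M : K) (c : cocone D M) (X : K).

(** Surjectivity and injectivity of the comparison map from the directed colimit of the sets
    [hom X (D i)] to [hom X M]. *)
Definition essentially_unique_factorization : Prop :=
  (forall f : hom X M, exists i (g : hom X (D i)), leg c i \oc g = f) /\
  (forall i (g h : hom X (D i)), leg c i \oc g = leg c i \oc h ->
     exists j (ij : ple i j), dmap D ij \oc g = dmap D ij \oc h).

(* Both conditions are read off by mapping the colimit to [Prop], seen as
   the two-element set: a subset of the colimit is a compatible family of
   subsets of the terms of the diagram. *)
Lemma hom_colimit_factorization :
  is_colimit (map_cocone (hom_functor X) c) -> essentially_unique_factorization.
Proof.
move=> colX; split.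
  (* [P] is the union of the images of the legs; it agrees with the constant predicate on every leg,
     so the two are equal. *)
  move=> f; pose P (f : hom X M) : Prop :=
    exists i (g : hom X (D i)), leg c i \oc g = f.
  have PT : P = fun _ => True.
    apply: (@colimit_hom_ext _ _ _ _ _ (Prop : types_cat) _ _ colX) => i.
    apply: funext => g /=; apply: propext; split=> // _.
    by exists i, g.
  by rewrite -/(P f) PT.
move=> i g h gh.
(* [Q k z] says that [z] and [g] become equal further up. The family descends to a predicate [u] on
   [hom X M], which cannot separate [g] from [h] since they have the same image there. *)
pose Q k (z : hom X (D k)) : Prop := exists l (il : ple i l) (kl : ple k l),
  dmap D il \oc g = dmap D kl \oc z.
have Qnat (k k' : poset_cat I) (kk' : hom k k') :
    (Q k' : @hom types_cat _ Prop) \oc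
      fmap (functor_comp (hom_functor X) D) kk' = Q k.
  rewrite /Q; apply: funext => z /=; apply: propext; split.
    move=> [l [il [kl E]]]; exists l, il.
    exists (ple_trans kk' kl).
    by rewrite E hcompA -(dmap_comp D kk' kl).
  move=> [l [il [kl E]]]; have [m lm k'm] := I_pairs l k'.
  exists m, (ple_trans il lm), k'm.
  rewrite hcompA (dmap_comp D _ _ (ple_trans kl lm)).
  by rewrite -(dmap_comp D il lm) -(dmap_comp D kl lm) -!hcompA E.
have [u [uQ _]] := colX (Prop : types_cat) (Cocone Qnat).
have : Q i g.
  by exists i, (ord_refl _ _ (ple_order I) i), (ord_refl _ _ (ple_order I) i).
have /= uQi := fun z => congr1 (fun v => v z) (uQ i).
rewrite -(uQi g) gh uQi => -[j [ij [ij' E]]].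
by exists j, ij; rewrite E (Prop_irrelevance ij ij').
Qed.

(** Send [f] to the value of [c'] at any of its factorizations; two factorizations merge at a later
    stage, so the choice does not matter. *)
Lemma factorization_hom_colimit :
  essentially_unique_factorization -> is_colimit (map_cocone (hom_functor X) c).
Proof.
move=> [fact uniq] N c'.
have /choice[u uP] (f : hom X M) : exists y : N,
    forall i (g : hom X (D i)), leg c i \oc g = f -> y = leg c' i g.
  have [i [g gf]] := fact f; exists (leg c' i g) => j h hf.
  have [k ik jk] := I_pairs i j.
  have [|l [kl E]] := uniq k (dmap D ik \oc g) (dmap D jk \oc h).
    by rewrite !hcompA !leg_dmap gf.
  have nat a b (ab : ple a b) (z : hom X (D a)) :
      leg c' b (dmap D ab \oc z) = leg c' a z.
    by rewrite -(leg_nat c' (ab : @hom (poset_cat I) a b)).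
  by rewrite -(nat _ _ ik) -(nat _ _ kl) E !nat.
exists u; split=> [i|v vP].
  by apply: funext => g /=; exact: uP.
apply: funext => f; have [i [g <-]] := fact f.
rewrite (uP _ i g) //.
by have /= <- := congr1 (fun w => w g) (vP i).
Qed.

End HomColimit.

(** * Closure properties of presentable objects *)

Lemma presentable_le (theta mu : smallType) (K : category) (X : K) :
  [set: theta] #<= [set: mu] -> presentable theta X -> presentable mu X.
Proof.
(* Every [mu]-directed poset is [theta]-directed. *)
move=> theta_mu preX I dirI; apply: preX => A Alt; apply: dirI.
exact: card_lt_le_trans Alt theta_mu.
Qed.

Section PresentableClosure.
Variables (mu : smallType) (mu_regular : regular_cardinal mu).
Variable K : category.

(** A factorization of [f \oc r] through a stage gives one of [f] by precomposing with [s];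
    equalities of maps are treated alike. *)
Lemma presentable_retract (X Y : K) (s : hom X Y) (r : hom Y X) :
  r \oc s = idm X -> presentable mu Y -> presentable mu X.
Proof.
move=> rs preY I dirI D M c colc.
have I_pairs := directed_bounded_pairs mu_regular dirI.
apply: factorization_hom_colimit => //.
have [fact uniq] := hom_colimit_factorization I_pairs (preY I dirI D M c colc).
split=> [f|i g h gh].
  have [i [g gf]] := fact (f \oc r); exists i, (g \oc s).
  by rewrite hcompA gf -hcompA rs hcompm1.
have [|j [ij E]] := uniq i (g \oc r) (h \oc r).
  by rewrite !hcompA gh.
exists j, ij; move: E => /(congr1 (fun k => k \oc s)).
by rewrite -!hcompA rs !hcompm1.
Qed.

(** A map out of [X] is given by fewer than [mu] maps subject to fewer than [mu] equations, and a
    [mu]-directed diagram settles all of them at a single stage. *)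
Lemma presentable_small_colimit (J : poset) (E : functor (poset_cat J) K)
    (X : K) (e : cocone E X) :
  [set: pelt J] #< [set: mu] -> is_colimit e ->
  (forall j, presentable mu (E j)) -> presentable mu X.
Proof.
move=> Jlt cole preE I dirI D M c colc.
have I_pairs := directed_bounded_pairs mu_regular dirI.
have bound (T : smallType) (t : T -> pelt I) : [set: T] #< [set: mu] ->
    exists i, forall x, ple (t x) i.
  move=> Tlt; have [|i iP] := dirI (range t); first exact: card_lt_image.
  by exists i => x; apply: iP; exists x.
have factE j := hom_colimit_factorization I_pairs (preE j I dirI D M c colc).
(* Each equation valid after [leg c p] already holds at some stage [t x]; fewer than [mu] such
   stages have a common bound. *)
have merge (T : smallType) (j : T -> pelt J) p
    (g h : forall x, hom (E (j x)) (D p)) :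
    [set: T] #< [set: mu] ->
    (forall x, leg c p \oc g x = leg c p \oc h x) ->
    exists q (pq : ple p q), forall x, dmap D pq \oc g x = dmap D pq \oc h x.
  move=> Tlt gh.
  have /choice[t tP] x := (factE (j x)).2 p _ _ (gh x).
  have [q qP] := bound _ t Tlt; have [r pr qr] := I_pairs p q.
  exists r, pr => x; have [pt ght] := tP x.
  have tr := ple_trans (qP x) qr.
  by rewrite -(dmap_comp D pt tr) -!hcompA ght.
apply: factorization_hom_colimit => //; split; last first.
  move=> p g h gh.
  have [||q [pq E']] := merge _ id p
    (fun j => g \oc leg e j) (fun j => h \oc leg e j).
  - exact: Jlt.
  - by move=> j; rewrite !hcompA gh.
  by exists q, pq; apply: (colimit_hom_ext cole) => j; rewrite -!hcompA E'.
move=> f.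
have /choice[t tP] j := (factE j).1 (f \oc leg e j).
have [p tp] := bound (pelt J) t Jlt.
have gex j : exists g : hom (E j) (D p), leg c p \oc g = f \oc leg e j.
  have [g gf] := tP j; exists (dmap D (tp j) \oc g).
  by rewrite hcompA leg_dmap.
pose g j := projT1 (cid (gex j)).
have gP j : leg c p \oc g j = f \oc leg e j := projT2 (cid (gex j)).
(* The maps [g j] need not form a cocone at stage [p]. There is one naturality equation per
   comparable pair, hence fewer than [mu], and all of them hold at stage [q]. *)
pose R := [set x : pelt J * pelt J | ple x.1 x.2].
have [||q [pq qP]] := merge R (fun x => (set_val x).1) p
    (fun x => g _ \oc dmap E (set_valP x)) (fun x => g _).
- have : R #< [set: mu].
    apply: (card_lt_sub (B := [set: pelt J] `*` [set: pelt J])) => //.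
    exact: card_lt_setX.
  by apply: card_le_lt_trans; rewrite (card_le_eql (card_setT R)).
- by move=> x; rewrite hcompA !gP -hcompA leg_dmap.
have nat (i j : poset_cat J) (ij : hom i j) :
    (dmap D pq \oc g j) \oc fmap E ij = dmap D pq \oc g i.
  pose x : R := exist (fun z => z \in R) (i, j) (mem_set (ij : R (i, j))).
  have /= <- := qP x.
  rewrite -hcompA; congr (_ \oc (_ \oc _)).
  by congr (fmap E _); exact: (@Prop_irrelevance (ple i j)).
have [u [uP _]] := cole (D q) (Cocone nat).
exists q, u; apply: (colimit_hom_ext cole) => j.
by rewrite -hcompA uP /= hcompA leg_dmap gP.
Qed.

End PresentableClosure.

(** * A colimit rebuilt from its small directed subdiagrams *)

Lemma subset_order (T : Type) : order (set T) (fun A B => A `<=` B).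
Proof.
split.
- by move=> A.
- by move=> A B C; exact: subset_trans.
- by move=> A B AB BA; apply/seteqP.
Qed.

Definition subset_poset (T : smallType) : poset := Poset (subset_order T).

Section Restriction.
Variables (K : category) (I : poset) (D : functor (poset_cat I) K).
Variable J : set (pelt I).

Program Definition restrict : functor (poset_cat (subposet J)) K :=
  {| fobj := fun j => D (set_val j);
     fmap := fun i j ij => fmap D (ij : @hom (poset_cat I) _ _) |}.
Next Obligation.
move=> i; rewrite -fmap1; congr (fmap D _).
exact: (@Prop_irrelevance (ple _ _)).
Qed.
Next Obligation.
move=> i j k jk ij; rewrite -fmapM; congr (fmap D _).
exact: (@Prop_irrelevance (ple _ _)).
Qed.

End Restriction.

Section SmallDirectedSubsets.
Variables (kappa mu : smallType).
Hypotheses (kappa_regular : regular_cardinal kappa).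
Hypotheses (mu_regular : regular_cardinal mu).
Hypotheses (kappa_mu : sharply_less kappa mu).
Variables (K : category) (K_colimits : has_directed_colimits kappa K).
Variables (I : poset) (I_directed : directed kappa I).
Variables (D : functor (poset_cat I) K).

Definition small_directed : set (set (pelt I)) :=
  [set J | J #< [set: mu] /\ directed kappa (subposet J)].

Definition small_directed_poset : poset :=
  @subposet (subset_poset (pelt I)) small_directed.

Let Q := small_directed_poset.

Lemma small_directed_cover (A : set (pelt I)) : A #< [set: mu] ->
  exists J : pelt Q, A `<=` set_val J.
Proof.
move=> Alt.
have [J [AJ Jlt Jdir]] :=
  directed_closure kappa_regular mu_regular kappa_mu I_directed Alt.
have QJ : small_directed J by [].
by exists (exist (fun z => z \in small_directed) J (mem_set QJ)).
Qed.

(** A union of members of [Q] need not be [kappa]-directed; regularity of [mu] keeps it [mu]-small,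
    so it can be enlarged to a member of [Q]. *)
Lemma small_directed_poset_directed : directed mu Q.
Proof.
move=> A Alt.
have [|J sub] := small_directed_cover (A := \bigcup_(J in A) set_val J).
  by apply: card_lt_bigcup => // J _; have [] := set_valP J.
by exists J => J' AJ' i J'i; apply: sub; exists J'.
Qed.

Lemma restrict_colimit (J : pelt Q) :
  exists (M : K) (c : cocone (restrict D (set_val J)) M), is_colimit c.
Proof. by apply: K_colimits; have [] := set_valP J. Qed.

Definition sub_colim (J : pelt Q) : K := projT1 (cid (restrict_colimit J)).

Definition sub_cocone (J : pelt Q) :
    cocone (restrict D (set_val J)) (sub_colim J) :=
  projT1 (cid (projT2 (cid (restrict_colimit J)))).

Lemma sub_cocone_colimit (J : pelt Q) : is_colimit (sub_cocone J).
Proof. exact: projT2 (cid (projT2 (cid (restrict_colimit J)))). Qed.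

(** Indexing by [i] with a membership proof, not by the subtype, lets the same [i] be viewed in
    different subsets [J]. *)
Definition sub_leg (J : pelt Q) (i : pelt I) (Ji : set_val J i) :
    hom (D i) (sub_colim J) :=
  leg (sub_cocone J) (exist (fun z => z \in set_val J) i (mem_set Ji)).

Lemma sub_leg_dmap (J : pelt Q) (i j : pelt I) (ij : ple i j)
    (Ji : set_val J i) (Jj : set_val J j) :
  sub_leg Jj \oc dmap D ij = sub_leg Ji.
Proof.
pose x : pelt (subposet (set_val J)) :=
  exist (fun z => z \in set_val J) i (mem_set Ji).
pose y : pelt (subposet (set_val J)) :=
  exist (fun z => z \in set_val J) j (mem_set Jj).
exact: (leg_nat (sub_cocone J) (ij : @hom (poset_cat (subposet _)) x y)).
Qed.

Lemma sub_colim_ext (J : pelt Q) (N : K) (f g : hom (sub_colim J) N) :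
  (forall i (Ji : set_val J i), f \oc sub_leg Ji = g \oc sub_leg Ji) -> f = g.
Proof.
move=> fg; apply: (colimit_hom_ext (sub_cocone_colimit (J := J))) => -[i Ji].
by have := fg i (set_mem Ji); rewrite /sub_leg (Prop_irrelevance (mem_set _) Ji).
Qed.

Lemma sub_colim_desc (J : pelt Q) (N : K)
    (t : forall i, set_val J i -> hom (D i) N) :
  (forall i j (ij : ple i j) Ji Jj, t j Jj \oc dmap D ij = t i Ji) ->
  exists u : hom (sub_colim J) N,
    forall i (Ji : set_val J i), u \oc sub_leg Ji = t i Ji.
Proof.
move=> t_nat.
have nat (x y : poset_cat (subposet (set_val J))) (xy : hom x y) :
    t _ (set_valP y) \oc fmap (restrict D (set_val J)) xy = t _ (set_valP x).
  exact: t_nat.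
have [u [uP _]] := sub_cocone_colimit (Cocone nat).
exists u => i Ji; rewrite (uP (exist _ i (mem_set Ji))) /=.
congr (t i _); exact: Prop_irrelevance.
Qed.

Lemma sub_map_ex (J J' : pelt Q) (JJ' : ple J J') :
  exists u : hom (sub_colim J) (sub_colim J'),
    forall i (Ji : set_val J i), u \oc sub_leg Ji = sub_leg (JJ' i Ji).
Proof. by apply: sub_colim_desc => i j ij Ji Jj; exact: sub_leg_dmap. Qed.

Definition sub_map (J J' : pelt Q) (JJ' : ple J J') :
  hom (sub_colim J) (sub_colim J') := projT1 (cid (sub_map_ex JJ')).

Lemma sub_map_leg (J J' : pelt Q) (JJ' : ple J J') i
    (Ji : set_val J i) (J'i : set_val J' i) :
  sub_map JJ' \oc sub_leg Ji = sub_leg J'i.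
Proof.
by rewrite (projT2 (cid (sub_map_ex JJ')) i Ji) (Prop_irrelevance J'i (JJ' i Ji)).
Qed.

Program Definition sub_colim_functor : functor (poset_cat Q) K :=
  {| fobj := sub_colim; fmap := fun J J' JJ' => sub_map JJ' |}.
Next Obligation.
by move=> J; apply: sub_colim_ext => i Ji; rewrite hcomp1m; exact: sub_map_leg.
Qed.
Next Obligation.
move=> J J' J'' J'J'' JJ'; apply: sub_colim_ext => i Ji.
rewrite -hcompA (sub_map_leg JJ' Ji (JJ' i Ji)).
by rewrite (sub_map_leg J'J'' _ (J'J'' _ (JJ' i Ji))); exact: sub_map_leg.
Qed.

Variables (M : K) (c : cocone D M).

Lemma sub_colim_to_ex (J : pelt Q) :
  exists u : hom (sub_colim J) M,
    forall i (Ji : set_val J i), u \oc sub_leg Ji = leg c i.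
Proof. by apply: sub_colim_desc => i j ij _ _; exact: leg_dmap. Qed.

Definition sub_colim_to (J : pelt Q) : hom (sub_colim J) M :=
  projT1 (cid (sub_colim_to_ex J)).

Lemma sub_colim_to_leg (J : pelt Q) i (Ji : set_val J i) :
  sub_colim_to J \oc sub_leg Ji = leg c i.
Proof. exact: (projT2 (cid (sub_colim_to_ex J))). Qed.

Program Definition sub_colim_cocone : cocone sub_colim_functor M :=
  {| leg := sub_colim_to |}.
Next Obligation.
move=> J J' JJ'; apply: sub_colim_ext => i Ji.
by rewrite -hcompA (sub_map_leg _ Ji (JJ' i Ji)) !sub_colim_to_leg.
Qed.

(** A cocone on the partial colimits amounts to a cocone on [D], because any two indices lie in a
    common small directed subset. *)
Lemma sub_colim_cocone_colimit : is_colimit c -> is_colimit sub_colim_cocone.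
Proof.
move=> colc N c'.
have singleton_lt (i : pelt I) : [set i] #< [set: mu].
  by apply: finite_card_lt mu_regular.1; exact: finite_set1.
have /choice[V Vi] (i : pelt I) : exists J : pelt Q, set_val J i.
  by have [J sub] := small_directed_cover (singleton_lt i); exists J; exact: sub.
pose t i : hom (D i) N := leg c' (V i) \oc sub_leg (Vi i).
(* The leg at [i] is the same for every [J] containing [i]: compare [J] and [V i] inside a common
   [J']. *)
have tE J i (Ji : set_val J i) : leg c' J \oc sub_leg Ji = t i.
  have [J' JJ' VJ'] :=
    directed_bounded_pairs mu_regular small_directed_poset_directed J (V i).
  rewrite /t -(leg_nat c' (JJ' : @hom (poset_cat Q) _ _)).
  rewrite -(leg_nat c' (VJ' : @hom (poset_cat Q) _ _)) -!hcompA /=.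
  by rewrite !(sub_map_leg _ _ (JJ' i Ji)).
(* Inside one [J] containing both [i] and [j], naturality is that of the partial colimit. *)
have t_nat (i j : poset_cat I) (ij : hom i j) : t j \oc fmap D ij = t i.
  have [J sub] := small_directed_cover
    (card_lt_setU mu_regular (singleton_lt i) (singleton_lt j)).
  have Ji : set_val J i by apply: sub; left.
  have Jj : set_val J j by apply: sub; right.
  by rewrite -(tE _ _ Ji) -(tE _ _ Jj) -hcompA (sub_leg_dmap ij Ji).
have [u [uP uU]] := colc N (Cocone t_nat).
exists u; split=> [J|v vP].
  by apply: sub_colim_ext => i Ji; rewrite -hcompA sub_colim_to_leg uP tE.
apply: uU => i /=.
by rewrite -(sub_colim_to_leg (Vi i)) hcompA vP.
Qed.

End SmallDirectedSubsets.

Theorem theorem4p7 (kappa lambda : smallType)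
    (kappa_regular : regular_cardinal kappa)
    (lambda_regular : regular_cardinal lambda)
    (kappa_le_lambda : [set: kappa] #<= [set: lambda])
    (K L : category) (F : functor K L)
    (K_accessible : accessible lambda K)
    (K_colimits : has_directed_colimits kappa K)
    (F_faithful : faithful F)
    (F_preserves : preserves_directed_colimits kappa F)
    (F_presentable : forall M : K, presentable lambda M -> presentable lambda (F M)) :
  forall mu : smallType,
    regular_cardinal mu -> sharply_less kappa mu ->
    [set: lambda] #<= [set: mu] ->
    forall M : K, presentable mu M -> presentable mu (F M).
Proof.
move=> mu mu_regular kappa_mu lambda_mu M preM.
have [_ [S [G [preG /(_ M)[I [D [c [dirI DG colc]]]]]]]] := K_accessible.
(* Closing small subsets of [I] under bounds requires [kappa]-directedness, which follows from
   [kappa_le_lambda]. *)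
have dirI' : directed kappa I.
  by move=> A Alt; apply: dirI; exact: card_lt_le_trans Alt kappa_le_lambda.
have Qdir :=
  small_directed_poset_directed kappa_regular mu_regular kappa_mu dirI'.
have colQ := sub_colim_cocone_colimit kappa_regular mu_regular kappa_mu
  (K_colimits := K_colimits) dirI' colc.
have [fact _] := hom_colimit_factorization
  (directed_bounded_pairs mu_regular Qdir) (preM _ Qdir _ _ _ colQ).
have [J [s rs]] := fact (idm M).
have Frs : fmap F (leg (sub_colim_cocone mu K_colimits c) J) \oc fmap F s =
    idm (F M) by rewrite -fmapM rs fmap1.
apply: (presentable_retract mu_regular Frs).
have [Jlt Jdir] := set_valP J.
apply: (presentable_small_colimit mu_regular _
  (F_preserves _ Jdir _ _ _ (sub_cocone_colimit K_colimits (D := D) (J := J)))).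
  by apply: card_le_lt_trans Jlt; rewrite (card_le_eql (card_setT (set_val J))).
(* Each [D j] is a generator, so its image under [F] is [lambda]-presentable, hence
   [mu]-presentable. *)
move=> j /=; have [x ->] := DG (set_val j).
exact: presentable_le lambda_mu (F_presentable _ (preG x)).
Qed.
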